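(* Let $G$ be a finite plane graph and $\mathcal{H}$ a collection of connected vertex sets of $G$ that spans $G$, each of which contains a vertex incident to the outer face of $G$. Let $\mathcal{B}$ be a collection of pairwise disjoint connected vertex sets of $G$ such that $I_{\mathcal{H}}(B)$ has weak diameter at most $30$ in $\mathbf{RIG}(G,\mathcal{H})$ for every $B\in\mathcal{B}$, and such that for every $B\in\mathcal{B}$, either $B$ contains a vertex incident to the outer face of $G$ and $I_{\mathcal{H}}(B)$ has weak diameter at most $10$ in $\mathbf{RIG}(G,\mathcal{H})$, or $B$ touches some $B'\in\mathcal{B}$ that contains a vertex incident to the outer face of $G$. Suppose further that for every vertex set $K$ of a connected component of $G-\bigcup_{B\in\mathcal{B}}B$, at least one of the following holds: (1) $I_{\mathcal{H}}(K)$ has weak diameter at most $10$ in $\mathbf{RIG}(G,\mathcal{H})$ and $K$ contains a vertex incident to the outer face of $G$; or $I_{\mathcal{H}}(K)$ has weak diameter at most $30$ in $\mathbf{RIG}(G,\mathcal{H})$ and $K$ touches some $B\in\mathcal{B}$ that contains a vertex incident to the outer face of $G$; (2) $K$ contains a vertex incident to the outer face of $G$ and touches no $B\in\mathcal{B}$; (3) $K$ contains a vertex incident to the outer face of $G$ and touches exactly one $B\in\mathcal{B}$; (4) $K$ contains a vertex incident to the outer face of $G$ and there exist distinct $B_1,B_2\in\mathcal{B}$ such that $K$ touches $B_1$ and $B_2$ and no other member of $\mathcal{B}$, both $B_1$ and $B_2$ contain a vertex incident to the outer face of $G$, and $B_1$ and $B_2$ both contain a vertex incident to a common face of $G$ other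 than the outer face. Then there is a collection $\mathcal{M}$ of pairwise disjoint connected vertex sets of $G$ with $\bigcup_{M\in\mathcal{M}}M=V(G)$ such that $I_{\mathcal{H}}(M)$ has weak diameter at most $30$ in $\mathbf{RIG}(G,\mathcal{H})$ for every $M\in\mathcal{M}$, and for every $M\in\mathcal{M}$, either $M$ contains a vertex incident to the outer face of $G$ and $I_{\mathcal{H}}(M)$ has weak diameter at most $10$ in $\mathbf{RIG}(G,\mathcal{H})$, or $M$ touches some $M'\in\mathcal{M}$ that contains a vertex incident to the outer face of $G$.
   Context: A plane graph is a planar graph with a fixed embedding; its outer face is the unbounded face. A vertex set $A$ is connected if $G[A]$ is connected. $\mathcal{H}$ spans $G$ if every edge of $G$ has both ends in some member of $\mathcal{H}$. The weak diameter of a vertex set $A$ in a graph $X$ is $\max_{a,b\in A}d_X(a,b)$. $I_{\mathcal{C}}(F)$ is the set of members of the collection $\mathcal{C}$ that intersect $F$. $\mathbf{RIG}(G,\mathcal{H})$ is the graph on $\mathcal{H}$ with distinct members adjacent iff they intersect. Two disjoint vertex sets touch if some edge of $G$ has one end in each. *)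

(* Defs.v *)
From HB Require Import structures.
From mathcomp Require Import all_boot all_order all_algebra.
From mathcomp Require Import all_classical all_reals all_analysis.
Set Implicit Arguments.
Unset Strict Implicit.
Unset Printing Implicit Defensive.
Import Order.TTheory GRing.Theory Num.Theory.
Import numFieldNormedType.Exports.

Section Graphs.
Variables (V : finType) (e : rel V).
Implicit Types (A B D F K : {set V}) (Hs : {set {set V}}).

(* As usual, the graph with no vertices does not count as connected. *)
Definition conn_set A : bool :=
  (A != finset.set0) &&
  [forall u in A, forall v in A,
     connect [rel x y | [&& x \in A, y \in A & e x y]] u v].

(* [K] is the vertex set of a component of the subgraph induced by [D]. *)
Definition is_component D K : bool :=
  maxset (fun A => conn_set A && (A \subset D)) K.

Definition touch A B : bool :=
  [disjoint A & B] && [exists u in A, exists v in B, e u v].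

Definition spans Hs : Prop :=
  forall u v, e u v -> exists2 H, H \in Hs & (u \in H) && (v \in H).

End Graphs.

Section Distance.
Variables (T : finType) (e : rel T).

(* d(x, y) <= n; distances between different components are infinite. *)
Definition dist_le (n : nat) (x y : T) : Prop :=
  exists p : seq T, [/\ path e x p, last x p = y & size p <= n].

Definition weak_diam_le (n : nat) (A : {set T}) : Prop :=
  forall a b, a \in A -> b \in A -> dist_le n a b.

End Distance.

Section Intersections.
Variable V : finType.

Definition meeting (C : {set {set V}}) (F : {set V}) : {set {set V}} :=
  [set X in C | ~~ [disjoint X & F]].

(* The graph RIG(G, Hs) as a relation on all of [{set V}]: sets outside [Hs]
   are isolated, so distances between members of [Hs] are those of the RIG. *)
Definition rig (Hs : {set {set V}}) : rel {set V} :=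
  [rel X Y | [&& X \in Hs, Y \in Hs, X != Y & ~~ [disjoint X & Y]]].

End Intersections.

Section PlaneGraphs.
Local Open Scope ring_scope.
Local Open Scope classical_set_scope.

Definition is_arc (R : realType) (A : set (R * R)) (x y : R * R) : Prop :=
  exists f : R -> R * R,
    [/\ {within `[0, 1], continuous f},
        {in `[0, 1] &, injective f},
        f 0 = x, f 1 = y & f @` `[0, 1] = A].

(* A finite simple graph drawn in the plane.  The value of [edge_arc] on pairs
   of non-adjacent vertices is irrelevant. *)
Record plane_graph (R : realType) := PlaneGraph {
  vertex : finType;
  adj : rel vertex;
  adj_sym : symmetric adj;
  adj_irr : irreflexive adj;
  pos : vertex -> R * R;
  pos_inj : injective pos;
  edge_arc : vertex -> vertex -> set (R * R);
  edge_arc_sym : forall u v, adj u v -> edge_arc u v = edge_arc v u;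
  edge_arc_is_arc : forall u v, adj u v -> is_arc (edge_arc u v) (pos u) (pos v);
  edge_arc_vertex : forall u v w,
    adj u v -> edge_arc u v (pos w) -> w = u \/ w = v;
  edge_arc_disjoint : forall u v u' v' p,
    adj u v -> adj u' v' ->
    (u', v') <> (u, v) -> (u', v') <> (v, u) ->
    edge_arc u v p -> edge_arc u' v' p -> exists w, p = pos w
}.

End PlaneGraphs.

Arguments adj {R} _ _ _.

Section Faces.
Local Open Scope classical_set_scope.
Variables (R : realType) (G : plane_graph R).

Definition drawing : set (R * R) :=
  [set p | (exists v : vertex G, p = pos v) \/
           (exists u v : vertex G, adj G u v /\ edge_arc u v p)].

Definition is_face (F : set (R * R)) : Prop :=
  exists2 x, (~` drawing) x & F = connected_component (~` drawing) x.

Definition is_outer_face (F : set (R * R)) : Prop :=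
  is_face F /\ ~ bounded_set F.

(* A face is incident to the vertices on its frontier. *)
Definition incident (v : vertex G) (F : set (R * R)) : Prop :=
  (closure F `\` interior F) (pos v).

Definition meets_face (A : {set vertex G}) (F : set (R * R)) : Prop :=
  exists2 v, v \in A & incident v F.

Definition meets_outer (A : {set vertex G}) : Prop :=
  exists2 F, is_outer_face F & meets_face A F.

End Faces.

(* Main.v *)
Require Import Defs.
From mathcomp Require Import all_boot all_order all_algebra.
From mathcomp Require Import zify lra.
From Stdlib Require Import Btauto.
From mathcomp Require Import all_classical all_reals all_analysis.
Set Implicit Arguments.
Unset Strict Implicit.
Unset Printing Implicit Defensive.
Import Order.TTheory GRing.Theory Num.Theory.
Import numFieldNormedType.Exports.

(** A vertex in no member of [Hs] is isolated, so the hypotheses on [Bs] put it on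
    the outer face.  The partition comes from breadth-first search in the region
    intersection graph.

    Give each [H] in [Hs] its distance [d H] from a root of its component of the
    RIG, and each vertex [v] the least depth [dv v] of a member containing it, so
    that [dv v <= d H <= dv v + 1] whenever [v] is in [H].  Group the depths as
    {0}, {1,2}, {3,4}, ...; the parts are the components of the subgraphs induced
    by these groups.  A member of depth [2j] lies entirely in group [j], so every
    part of group [j+1] touches an outer part of group [j].

    For the diameter, let [X] be a component of the vertices deeper than [k = 2j].
    Three members of depth [k] that are adjacent to [X] and pairwise at distance
    at least 4, extended by parts of their predecessors, would be three disjoint
    connected outer sets, each touching both [X] and the vertices of depth at most
    [k - 2] around the root.  Together with the outer face this is a drawing of
    K_{3,3}.  Hence the members of depth [k] adjacent to [X] lie in two balls of
    radius 3, the members meeting a part lie in two balls of radius 6, and the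
    diameter is at most 25.

    For K_{3,3} no Jordan curve theorem is needed: the argument is the
    van Kampen parity obstruction, applied to chains of points approximating the
    nine edges.  It only requires the images of non-adjacent edges to be disjoint,
    so an edge may be any continuum joining its ends. *)

(** * Arithmetic of parities *)

Lemma addb_xorb b c : b (+) c = xorb b c. Proof. by case: b; case: c. Qed.

Lemma addb_eq b c : b (+) c = false -> b = c. Proof. by case: b; case: c. Qed.

(** Closes a goal that is the sum over GF(2) of the equations [h1] and [h2], up to cancellation of
    repeated terms. *)
Ltac add_parities h1 h2 :=
  match type of h1 with ?l1 = ?r1 => match type of h2 with ?l2 = ?r2 =>
    apply: addb_eq; transitivity ((l1 (+) r1) (+) (l2 (+) r2));
    [rewrite !addb_xorb; btauto | by rewrite h1 h2 !addbb]
  end end.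

(** * Crossings of a ray by chains of points *)

Section RayCrossings.
Local Open Scope ring_scope.
Variable R : realType.
Implicit Types (x y p a b c d u w : R * R) (s t : seq (R * R)) (r : R).

(* Crossing of the positive x-axis by the segment from [u] to [w].  Testing the
   abscissa of [u] alone is harmless: the two points are always closer to each
   other than to the origin, so a crossing forces their abscissae to agree in
   sign. *)
Definition crosses_ray u w : bool := ((0 <= u.2) (+) (0 <= w.2)) && (0 < u.1).

(** An open half-plane with one of its boundary rays added, so that it contains exactly one of [u]
    and [- u] when [u] is nonzero. *)
Definition lex_pos u : bool := (0 < u.2) || (u.2 == 0) && (0 < u.1).

Lemma lex_posN u : u != 0 -> lex_pos (- u) = ~~ lex_pos u.
Proof.
case: u => u1 u2; rewrite /lex_pos /= oppr_gt0 oppr_eq0 oppr_gt0 => u0.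
case: (ltgtP u2 0) => //= u20; case: (ltgtP u1 0) => //= u10.
by move: u0; rewrite u10 u20 eqxx.
Qed.

Lemma norm_pair_lt u r : `|u| < r -> `|u.1| < r /\ `|u.2| < r.
Proof.
by case: u => u1 u2; rewrite prod_normE /= gt_max => /andP.
Qed.

Lemma norm_pair_ge u r : r <= `|u| -> r <= `|u.1| \/ r <= `|u.2|.
Proof.
by case: u => u1 u2; rewrite prod_normE /= le_max => /orP.
Qed.

(** The closed walk [u1], [u2], [u4], [u3] is too small to wind around the origin. If its ordinates
    take both signs, its abscissae are forced to agree in sign, so either none or all of the sign
    changes count, and a closed walk has an even number of them. *)
Lemma crosses_square r u1 u2 u3 u4 :
  (forall u w, u \in [:: u1; u2; u3; u4] -> w \in [:: u1; u2; u3; u4] ->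
     `|u - w| < r) ->
  (forall u, u \in [:: u1; u2; u3; u4] -> r <= `|u|) ->
  crosses_ray u1 u2 (+) crosses_ray u3 u4 (+) crosses_ray u1 u3
    (+) crosses_ray u2 u4 = false.
Proof.
move=> near far.
have same u w v : u \in [:: u1; u2; u3; u4] -> w \in [:: u1; u2; u3; u4] ->
    v \in [:: u1; u2; u3; u4] -> 0 <= u.2 -> w.2 < 0 -> (0 < v.1) = (0 < u.1).
  move=> ui wi vi u0 w0.
  have [] := norm_pair_lt (near _ _ ui wi); have [] := norm_pair_lt (near _ _ ui vi).
  have [] := norm_pair_lt (near _ _ wi vi).
  rewrite /= !ltr_norml.
  move=> /andP[? ?] /andP[? ?] /andP[? ?] /andP[? ?] /andP[? ?] /andP[? ?].
  have fu : r <= `|u.1|.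
    have [//|] := norm_pair_ge (far _ ui); rewrite ger0_norm //; lra.
  have fv : r <= `|v.1|.
    have [//|] := norm_pair_ge (far _ vi).
    by case: (ler0P v.2) => ? ?; lra.
  move: fu fv; case: (ler0P u.1) => ? ?; case: (ler0P v.1) => ? ? //; lra.
have i1 : u1 \in [:: u1; u2; u3; u4] by rewrite !inE eqxx.
have i2 : u2 \in [:: u1; u2; u3; u4] by rewrite !inE eqxx ?orbT.
have i3 : u3 \in [:: u1; u2; u3; u4] by rewrite !inE eqxx ?orbT.
have i4 : u4 \in [:: u1; u2; u3; u4] by rewrite !inE eqxx ?orbT.
rewrite /crosses_ray.
have eqx u w : u \in [:: u1; u2; u3; u4] -> w \in [:: u1; u2; u3; u4] ->
    [|| (0 <= u1.2) (+) (0 <= u2.2), (0 <= u1.2) (+) (0 <= u3.2) |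
        (0 <= u1.2) (+) (0 <= u4.2)] -> (0 < u.1) = (0 < w.1).
  move=> ui wi.
  have pick v v' : v \in [:: u1; u2; u3; u4] -> v' \in [:: u1; u2; u3; u4] ->
      (0 <= v.2) (+) (0 <= v'.2) -> (0 < u.1) = (0 < w.1).
    move=> vi v'i; case: (lerP 0 v.2) => hv; case: (lerP 0 v'.2) => hv' //= _.
      by rewrite (same v v' u) // (same v v' w).
    by rewrite (same v' v u) // (same v' v w).
  by case/or3P; apply: pick.
move: (eqx _ _ i1 i2) (eqx _ _ i1 i3).
by do 4!case: (0 <= _); do 3!case: (0 < _) => //=; move=> // h1 h2;
  move: (h1 isT) (h2 isT).
Qed.

(** A segment crossing the x-axis meets its positive or its negative half, and negation swaps the
    two. The change of [lex_pos] registers a crossing of the whole axis. *)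
Lemma crosses_rayN r u w : `|u - w| < r -> r <= `|u| -> r <= `|w| ->
  crosses_ray u w = crosses_ray (- u) (- w) (+) lex_pos (- u) (+) lex_pos (- w).
Proof.
case: u w => u1 u2 [w1 w2] /norm_pair_lt[/= hn1 hn2] /norm_pair_ge/= hu /norm_pair_ge/= hw.
rewrite /crosses_ray /lex_pos /= !oppr_ge0 !oppr_gt0 !oppr_eq0.
move: hn1 hn2; rewrite !ltr_norml => /andP[? ?] /andP[? ?].
have hx : (u2 <= 0 <= w2) || (w2 <= 0 <= u2) ->
    (0 < u1) = (0 < w1) /\ (u1 < 0) = ~~ (0 < u1) /\ (w1 < 0) = ~~ (0 < w1).
  move=> h2.
  have {}hu : r <= `|u1|.
    by case: hu => //; case: (ler0P u2) => ? ?; case/orP: h2 => /andP[? ?]; lra.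
  have {}hw : r <= `|w1|.
    by case: hw => //; case: (ler0P w2) => ? ?; case/orP: h2 => /andP[? ?]; lra.
  by move: hu hw; case: (ltrgt0P u1) => ? ?; case: (ltrgt0P w1) => ? ? //; lra.
move: hx; case: (ltgtP u2 0) => hu2; case: (ltgtP w2 0) => hw2 //= hx; rewrite ?addbF //.
all: by have [//|e1 [e2 e3]] := hx; rewrite ?e2 ?e3 ?e1; case: (0 < w1).
Qed.

(** For a closed chain of short steps that stays away from [p], this is the parity of the winding
    number around [p]. *)
Fixpoint ray_parity p x s : bool :=
  if s is y :: s' then crosses_ray (x - p) (y - p) (+) ray_parity p y s'
  else false.

Definition lex_parity x y c d : bool :=
  lex_pos (c - x) (+) lex_pos (d - x) (+) lex_pos (c - y) (+) lex_pos (d - y).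

(* Discrete form of the fact that the direction map (u, w) |-> (u - w) / |u - w|
   on a product of two disjoint arcs has winding number 0 along the boundary of
   the square; [lex_parity] is the cost of replacing [u - w] by [w - u] on two of
   its sides. *)
Lemma ray_parity_chains r x s c t :
  path (fun u w => `|u - w| < r / 2) x s ->
  path (fun u w => `|u - w| < r / 2) c t ->
  (forall u w, u \in x :: s -> w \in c :: t -> r <= `|u - w|) ->
  ray_parity c x s (+) ray_parity (last c t) x s
    (+) ray_parity x c t (+) ray_parity (last x s) c t
    = lex_parity x (last x s) c (last c t).
Proof.
rewrite /lex_parity.
elim: s x => [|y s IHs] x /=.
  by move=> _ _ _; rewrite addbb -addbA addbb.
case/andP=> xy ys ct far.
have {}IHs := IHs y ys ct (fun u w ui => far u w (@mem_behead _ (x :: y :: s) _ ui)).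
(* It remains to treat one step of the first chain against the whole second chain, by an inner
   induction on the latter. *)
suff step : crosses_ray (x - c) (y - c) (+) crosses_ray (x - last c t) (y - last c t)
    (+) ray_parity x c t (+) ray_parity y c t =
    lex_pos (c - x) (+) lex_pos (last c t - x) (+) lex_pos (c - y) (+) lex_pos (last c t - y).
  add_parities IHs step.
have {}far u w : u \in [:: x; y] -> w \in c :: t -> r <= `|u - w|.
  by move=> ui; apply: far; move: ui; rewrite !inE => /orP[]-> //; rewrite orbT.
elim: t c ct far {IHs} => [|d t IHt] c /=.
  by move=> _ _; rewrite !addb_xorb; btauto.
case/andP=> cd dt far.
have {}IHt := IHt d dt (fun u w ui wi => far u w ui (@mem_behead _ (c :: d :: t) _ wi)).
have [ix iy ic id] : [/\ x \in [:: x; y], y \in [:: x; y], c \in [:: c, d & t]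
    & d \in [:: c, d & t]] by rewrite !inE !eqxx ?orbT.
have nearN u w : `|u - w| < r -> `|w - u| < r by rewrite distrC.
have r0 : 0 < r by move: (normr_ge0 (x - y)) xy; lra.
(* One step in each chain gives four differences. Each step is shorter than [r / 2], so the
   differences are pairwise closer than [r]. *)
have sq : crosses_ray (x - c) (y - c) (+) crosses_ray (x - d) (y - d)
   (+) crosses_ray (x - c) (x - d) (+) crosses_ray (y - c) (y - d) = false.
  apply: (@crosses_square r).
    have xy' : `|y - x| < r / 2 by rewrite distrC.
    have cd' : `|d - c| < r / 2 by rewrite distrC.
    have le2 u w v v' : `|u - w| < r / 2 -> `|v - v'| < r / 2 -> `|(u - v) - (w - v')| < r.
      move=> h1 h2; have -> : (u - v) - (w - v') = (u - w) - (v - v').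
        by rewrite !opprB addrACA [RHS]addrACA; congr (_ + _); rewrite addrC.
      by apply: le_lt_trans (ler_normB _ _) _; lra.
    have le0 u : `|u - u| < r / 2 by rewrite subrr normr0; lra.
    by move=> u w; rewrite !inE => /or4P[]/eqP-> /or4P[]/eqP->; apply: le2.
  by move=> u; rewrite !inE => /or4P[]/eqP->; apply: far.
(* The goal measures the step of the second chain from [z], with differences of the opposite sign;
   reversing them produces the [lex_pos] terms. *)
have cN z : z \in [:: x; y] -> crosses_ray (z - c) (z - d) =
    crosses_ray (c - z) (d - z) (+) lex_pos (c - z) (+) lex_pos (d - z).
  move=> zi; rewrite (@crosses_rayN r) ?far // ?opprB //.
  have -> : z - c + (d - z) = d - c by rewrite addrC addrA subrK.
  by rewrite distrC; lra.
rewrite !cN // in sq.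
add_parities sq IHt.
Qed.
End RayCrossings.

(** * Chains in continua and K_{3,3} *)

Section Continua.
Local Open Scope classical_set_scope.
Local Open Scope ring_scope.
Variable R : realType.

(** The points of [A] reachable by such chains form a nonempty relatively clopen subset. *)
Lemma connected_chain (V : normedModType R) (A : set V) (r : R) x y :
    0 < r -> connected A -> A x -> A y ->
  exists s, [/\ path (fun u w => `|u - w| < r) x s, last x s = y
              & forall u, u \in x :: s -> A u].
Proof.
move=> r0 cA Ax Ay.
pose W := [set z | A z /\ exists s, [/\ path (fun u w => `|u - w| < r) x s,
  last x s = z & forall u, u \in x :: s -> A u]].
have step z w : W z -> A w -> `|z - w| < r -> W w.
  move=> [Az [s [ps ls As]]] Aw zw; split=> //; exists (rcons s w).
  rewrite rcons_path ps ls last_rcons; split=> // u.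
  by rewrite -rcons_cons mem_rcons inE => /predU1P[->|/As].
have opn (P : set V) : open [set z | exists2 w, P w & `|w - z| < r].
  have -> : [set z | exists2 w, P w & `|w - z| < r] = \bigcup_(w in P) ball w r.
    by apply/seteqP; split=> z [w Pw wz]; exists w => //; move: wz; rewrite -ball_normE.
  by apply: bigcup_open => w _; exact: ball_open.
suff WA : W = A by have [] : W y by rewrite WA.
apply: cA.
- by exists x; split=> //; exists [::]; split=> // u; rewrite inE => /eqP->.
- exists [set z | exists2 w, W w & `|w - z| < r] => //.
  apply/seteqP; split=> z; last by case=> Az [w Ww]; exact: step.
  by move=> Wz; split; [case: Wz|exists z => //; rewrite subrr normr0].
- exists (~` [set z | exists2 w, (A `\` W) w & `|w - z| < r]).
    by rewrite closedC.
  apply/seteqP; split=> z.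
    move=> Wz; split; first by case: Wz.
    by case=> w [Aw nWw] wz; apply: nWw; apply: (step z) => //; rewrite distrC.
  case=> Az nz; apply: contrapT => nWz; apply: nz; exists z => //.
  by rewrite subrr normr0.
Qed.

Lemma compact_dist_gt0 (V : normedModType R) (A B : set V) :
    compact A -> compact B -> A `&` B = set0 ->
  exists2 r : R, 0 < r & forall a b, A a -> B b -> r <= `|a - b|.
Proof.
move=> cA cB AB0.
have [[[a0 b0] [/= Aa0 Bb0]]|] := pselect (A `*` B !=set0); last first.
  by move=> nAB; exists 1 => // a b Aa Bb; exfalso; apply: nAB; exists (a, b).
have cont : continuous (fun z : V * V => `|z.1 - z.2|).
  move=> z; apply: cvg_norm.
  by apply: cvgB; [exact: cvg_fst|exact: cvg_snd].
have [|[a b]] := compact_EVT_min _ (compact_setX cA cB) (continuous_subspaceT cont).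
  by exists (a0, b0).
rewrite inE => -[/= Aa Bb] mini; exists `|a - b|.
  rewrite normr_gt0 subr_eq0; apply/eqP => ab.
  by have : (A `&` B) a; [split=> //; rewrite ab|rewrite AB0].
by move=> c d Ac Bd; apply: (mini (c, d)); rewrite inE.
Qed.

(** Each pair of non-adjacent edges yields one relation from [ray_parity_chains]; the eighteen
    relations add up to 0 = 1 modulo 2. *)
Lemma no_continua_K33 (p q : 'I_3 -> R * R) (E : 'I_3 -> 'I_3 -> set (R * R)) :
    (forall i j, compact (E i j)) -> (forall i j, connected (E i j)) ->
    (forall i j, E i j (p i)) -> (forall i j, E i j (q j)) ->
    (forall i j k l, i != k -> j != l -> E i j `&` E k l = set0) -> False.
Proof.
move=> cptE conE Ep Eq disj.
have [r r0 far] : exists2 r : R, 0 < r & forall i j k l, i != k -> j != l ->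
    forall a b, E i j a -> E k l b -> r <= `|a - b|.
  have ex (t : 'I_3 * 'I_3 * 'I_3 * 'I_3) : exists r : R, 0 < r /\
      (t.1.1.1 != t.1.2 -> t.1.1.2 != t.2 ->
       forall a b, E t.1.1.1 t.1.1.2 a -> E t.1.2 t.2 b -> r <= `|a - b|).
    case: t => [[[i j] k] l] /=.
    have [ik|] := boolP (i != k); last by exists 1.
    have [jl|] := boolP (j != l); last by exists 1.
    have [r r0 h] := compact_dist_gt0 (cptE i j) (cptE k l) (disj _ _ _ _ ik jl).
    by exists r.
  have [f fP] := choice ex.
  exists (\big[Order.min/1]_t f t).
    by apply: lt_bigmin => // t _; case: (fP t).
  move=> i j k l ik jl a b Ea Eb.
  have := (fP (i, j, k, l)).2 ik jl a b Ea Eb.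
  apply: le_trans; exact: bigmin_inf.
have /choice[s sP] : forall t : 'I_3 * 'I_3, exists s,
    [/\ path (fun u w => `|u - w| < r / 2) (p t.1) s, last (p t.1) s = q t.2
      & forall u, u \in p t.1 :: s -> E t.1 t.2 u].
  by move=> [i j]; apply: connected_chain => //; rewrite divr_gt0.
pose X i j v := ray_parity v (p i) (s (i, j)).
have rel i j k l : i != k -> j != l ->
    X i j (p k) (+) X i j (q l) (+) X k l (p i) (+) X k l (q j) =
    lex_parity (p i) (q j) (p k) (q l).
  move=> ik jl; have [s1 s2 s3] := sP (i, j); have [t1 t2 t3] := sP (k, l).
  rewrite -[in LHS]t2 -[in LHS]s2 -[in RHS]t2 -[in RHS]s2.
  by apply: (ray_parity_chains s1 t1) => u w /s3 Eu /t3 Ew; apply: far Eu Ew.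
(* Were [q j] and [q l] equal, two non-adjacent edges would meet there; so their difference is
   nonzero and [lex_posN] applies. *)
have qN j l : j != l -> lex_pos (q l - q j) = ~~ lex_pos (q j - q l).
  move=> jl; rewrite -opprB lex_posN // subr_eq0; apply/eqP => qq.
  have : (E 0 j `&` E 1 l) (q j) by split=> //; rewrite qq.
  by rewrite disj.
(* In the sum over all pairs of non-adjacent edges every ray parity occurs twice,
   and the [lex_pos] terms cancel except for one [qN] per pair of points [q]. *)
have tot : \big[addb/false]_(i < 3) \big[addb/false]_(k < 3 | (i < k)%N)
    \big[addb/false]_(j < 3) \big[addb/false]_(l < 3 | j != l)
    (X i j (p k) (+) X i j (q l) (+) X k l (p i) (+) X k l (q j) (+)
    lex_parity (p i) (q j) (p k) (q l)) = false.
  apply: big1 => i _; apply: big1 => k ik; apply: big1 => j _; apply: big1 => l jl.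
  by rewrite rel ?addbb // neq_ltn ik.
pose i0 : 'I_3 := 0; pose i1 : 'I_3 := 1; pose i2 : 'I_3 := 2%:R.
have E3 (P : pred 'I_3) F : \big[addb/false]_(i < 3 | P i) F i =
  (P i0 && F i0) (+) (P i1 && F i1) (+) (P i2 && F i2).
  rewrite big_mkcond !big_ord_recl big_ord0 /= addbF.
  have -> : lift ord0 (lift ord0 ord0) = i2 by apply: val_inj.
  have -> : lift ord0 ord0 = i1 by apply: val_inj.
  exact: addbA.
move: tot; rewrite !E3 /= /lex_parity.
rewrite (@qN i0 i1) // (@qN i0 i2) // (@qN i1 i2) // !addbF !addb_xorb.
set L := (X in X = false).
suff -> : L = true by [].
by rewrite /L; btauto.
Qed.

End Continua.

(** * Points joined by continua *)

Section Joined.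
Local Open Scope classical_set_scope.
Local Open Scope ring_scope.
Variables (R : realType) (V : normedModType R).
Implicit Types (U : set V) (x y z : V).

(** Continua take the place of paths: unions give transitivity without reparametrisation, and
    [no_continua_K33] accepts them as edges. *)
Definition joined U x y : Prop :=
  exists C, [/\ compact C, connected C, C `<=` U, C x & C y].

Lemma joined_sym U x y : joined U x y -> joined U y x.
Proof. by move=> [C [? ? ? ? ?]]; exists C. Qed.

Lemma joined_trans U y x z : joined U x y -> joined U y z -> joined U x z.
Proof.
move=> [C [kC cC CU Cx Cy]] [D [kD cD DU Dy Dz]]; exists (C `|` D); split.
- exact: compactU.
- by apply: connectedU => //; exists y.
- by rewrite subUset.
- by left.
- by right.
Qed.

Lemma joined_segment U x y :
  (forall t : R, 0 <= t <= 1 -> U (x + t *: (y - x))) -> joined U x y.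
Proof.
move=> seg; exists ((fun t : R => x + t *: (y - x)) @` `[0, 1]).
have cont : {within `[(0 : R), 1], continuous (fun t : R => x + t *: (y - x))}.
  apply: continuous_subspaceT => t.
  by apply: cvgD; [exact: cvg_cst|apply: cvgZl; exact: cvg_id].
split.
- exact/continuous_compact/segment_compact.
- exact/connected_continuous_connected/cont/segment_connected.
- by move=> _ [t + <-]; rewrite /= in_itv /= => /seg.
- by exists 0; rewrite /= ?in_itv /= ?lexx ?ler01// scale0r addr0.
- by exists 1; rewrite /= ?in_itv /= ?lexx ?ler01// scale1r addrC subrK.
Qed.

Lemma joined_ball U x y r : ball x r `<=` U -> ball x r y -> joined U x y.
Proof.
move=> rU; rewrite -ball_normE /= => xy; apply: joined_segment => t /andP[t0 t1].
apply: rU; rewrite -ball_normE /= opprD addNKr normrN normrZ ger0_norm //.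
by rewrite distrC; apply: le_lt_trans xy; rewrite ler_piMl.
Qed.

(** The classes of [joined U] are open because balls contain the segments from their centres. The
    complement of a class in [U] is a union of such classes, so a class fills every component that
    it meets. *)
Lemma joined_component U a x y : open U ->
  connected_component U a x -> connected_component U a y -> joined U x y.
Proof.
move=> oU ax ay; pose F := connected_component U a.
have FU : F `<=` U by exact: connected_component_sub.
have opn z : open [set w | joined U z w].
  rewrite openE => w [C [kC cC CU Cz Cw]].
  have /nbhs_ballP[r /= r0 rU] : nbhs w U by move: oU; rewrite openE; apply; exact: CU.
  apply/nbhs_ballP; exists r => //= v wv.
  by apply: (@joined_trans _ w); [exists C|exact: joined_ball wv].
have refl z : U z -> joined U z z.
  by move=> Uz; apply: joined_segment => t _; rewrite subrr scaler0 addr0.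
pose W := F `&` [set w | joined U x w].
suff WF : W = F by have [] : W y by rewrite WF.
apply: component_connected.
- by exists x; split=> //; apply: refl; exact: FU.
- by exists [set w | joined U x w].
- exists (~` \bigcup_(z in U `\` [set w | joined U x w]) [set w | joined U z w]).
    by rewrite closedC; apply: bigcup_open.
  apply/seteqP; split=> w [Fw xw]; split=> //.
    by case=> z [_ nxz] zw; apply: nxz; apply: joined_trans xw _; exact: joined_sym.
  apply: contrapT => nxw; apply: xw; exists w; last by apply: refl; exact: FU.
  by split=> //; exact: FU.
Qed.

End Joined.

Section JoinedFar.
Local Open Scope ring_scope.

(** The norm is the maximum norm, so the region beyond [m] is a union of four half-planes. Each is
    convex, and neighbouring ones overlap at the corners of a square. *)
Lemma joined_far (R : realType) (U : set (R * R)) (m : R) x :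
  0 <= m -> (forall z, m < `|z| -> U z) -> m < `|x| -> joined U x (m + 1, m + 1).
Proof.
move=> m0 mU mx.
have seg (h : R * R -> R) y z : (forall u, h u <= `|u|) ->
    (forall t : R, h (y + t *: (z - y)) = h y + t * (h z - h y)) ->
    m < h y -> m < h z -> joined U y z.
  move=> hn hl hy hz; apply: joined_segment => t /andP[t0 t1]; apply: mU.
  apply: lt_le_trans (hn _); rewrite hl; case: (lerP (h y) (h z)) => yz.
    by apply: lt_le_trans hy _; rewrite lerDl mulr_ge0 // subr_ge0.
  have : 0 <= (1 - t) * (h y - h z) by rewrite mulr_ge0 // subr_ge0 // ltW.
  by rewrite mulrBl mul1r; lra.
have n1 (u : R * R) : u.1 <= `|u|.
  by case: u => u1 u2; rewrite prod_normE /= le_max ler_norm.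
have n2 (u : R * R) : u.2 <= `|u|.
  by case: u => u1 u2; rewrite prod_normE /= le_max ler_norm orbT.
have n3 (u : R * R) : - u.1 <= `|u|.
  by case: u => u1 u2; rewrite prod_normE /= le_max -normrN ler_norm.
have n4 (u : R * R) : - u.2 <= `|u|.
  by case: u => u1 u2; rewrite prod_normE /= le_max -[`|u2|]normrN ler_norm orbT.
have right y z : m < y.1 -> m < z.1 -> joined U y z.
  by apply: (seg fst).
have up y z : m < y.2 -> m < z.2 -> joined U y z.
  by apply: (seg snd).
have left y z : m < - y.1 -> m < - z.1 -> joined U y z.
  by apply: (seg (fun u => - u.1)) => // t /=; rewrite /GRing.scale /=; lra.
have down y z : m < - y.2 -> m < - z.2 -> joined U y z.
  by apply: (seg (fun u => - u.2)) => // t /=; rewrite /GRing.scale /=; lra.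
case: x mx => x1 x2; rewrite prod_normE /= lt_max !ltr_normr.
case/orP=> /orP[] mx.
- by apply: right => /=; lra.
- apply: (@joined_trans _ _ _ (- m - 1, m + 1)); first by apply: left => /=; lra.
  by apply: up => /=; lra.
- by apply: up => /=; lra.
- apply: (@joined_trans _ _ _ (m + 1, - m - 1)); first by apply: down => /=; lra.
  by apply: right => /=; lra.
Qed.

End JoinedFar.

(** * Connected vertex sets *)

Lemma conn_setP (V : finType) (e : rel V) (A : {set V}) :
  reflect ((exists v, v \in A) /\
     {in A &, forall u v, connect [rel x y | [&& x \in A, y \in A & e x y]] u v})
    (conn_set e A).
Proof.
apply: (iffP andP) => [[/set0Pn Ane /forall_inP conA]|[/set0Pn Ane conA]]; split=> //.
  by move=> u v uA vA; exact: (forall_inP (conA u uA)).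
by apply/forall_inP => u uA; apply/forall_inP => v vA; exact: conA.
Qed.

Lemma connect_rel_mono (V : finType) (e e' : rel V) :
  subrel e e' -> subrel (connect e) (connect e').
Proof. by move=> sub; apply: connect_sub => x y /sub; exact: connect1. Qed.

Lemma conn_setU (V : finType) (e : rel V) (A B : {set V}) : symmetric e ->
  conn_set e A -> conn_set e B ->
  (exists u v, [/\ u \in A, v \in B & (u == v) || e u v]) -> conn_set e (A :|: B).
Proof.
move=> esym /conn_setP[[a aA] conA] /conn_setP[[b bB] conB] [u [v [uA vB uv]]].
apply/conn_setP; split; first by exists a; rewrite inE aA.
set r := [rel x y | _].
have rsym : symmetric r by move=> x y /=; rewrite esym andbCA.
have inA x y : x \in A -> y \in A -> connect r x y.
  move=> xA yA; apply: connect_rel_mono (conA _ _ xA yA) => z w /= /and3P[zA wA ->].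
  by rewrite !inE zA wA.
have inB x y : x \in B -> y \in B -> connect r x y.
  move=> xA yA; apply: connect_rel_mono (conB _ _ xA yA) => z w /= /and3P[zA wA ->].
  by rewrite !inE zA wA !orbT.
have ruv : connect r u v.
  by case/orP: uv => [/eqP->//|uv]; apply: connect1; rewrite /= !inE uA vB orbT.
have rvx x : x \in A :|: B -> connect r u x.
  by rewrite inE => /orP[|xB]; [exact: inA|apply: connect_trans ruv _; exact: inB].
move=> x y xAB yAB; apply: connect_trans (rvx _ yAB).
by rewrite (sym_connect_sym rsym); exact: rvx.
Qed.

(** * Drawings of induced subgraphs and the outer face *)

Section Subdrawings.
Local Open Scope classical_set_scope.
Local Open Scope ring_scope.
Variables (R : realType) (G : plane_graph R).
Implicit Types (S T : {set vertex G}) (u v w : vertex G).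

Definition subdrawing S : set (R * R) :=
  [set p | (exists2 v, v \in S & p = pos v) \/
           (exists u v, [/\ u \in S, v \in S, adj G u v & edge_arc u v p])].

Lemma subdrawing_setT : subdrawing [set: vertex G]%SET = drawing G.
Proof.
apply/seteqP; split=> p.
  by case=> [[v _ ->]|[u [v [_ _ uv pe]]]]; [left; exists v|right; exists u, v].
by case=> [[v ->]|[u [v [uv pe]]]]; [left; exists v|right; exists u, v].
Qed.

Lemma subdrawing_mono S T : S \subset T -> subdrawing S `<=` subdrawing T.
Proof.
move=> /fintype.subsetP ST p [[v /ST vT ->]|[u [v [/ST uT /ST vT uv pe]]]].
  by left; exists v.
by right; exists u, v.
Qed.

(** Arcs of different edges meet only at vertices, and a vertex on an arc is one of its ends, so a
    common point would be a common vertex of [S] and [T]. *)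
Lemma subdrawing_disjoint S T :
  [disjoint S & T]%B -> subdrawing S `&` subdrawing T = set0.
Proof.
move=> dST; apply/eqP/negPn/negP => /eqP/eqP/set0P[p [pS pT]].
have nST v : v \in S -> v \in T -> False.
  by move=> vS vT; rewrite (disjointFr dST vS) in vT.
case: pS pT => [[v vS ->]|[u [v [uS vS uv pe]]]] [[v' v'T e]|[u' [v' [u'T v'T u'v' pe']]]].
- by apply: (nST v) => //; rewrite (pos_inj e).
- by case: (edge_arc_vertex u'v' pe') => vv; apply: (nST v) => //; rewrite vv.
- by rewrite e in pe; case: (edge_arc_vertex uv pe) => vv; apply: (nST v') => //; rewrite vv.
- have [w pw] : exists w, p = pos w.
    by apply: (edge_arc_disjoint uv u'v' _ _ pe pe') => -[e1 e2];
      apply: (nST u') => //; rewrite e1.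
  rewrite pw in pe pe'.
  have wS : w \in S by case: (edge_arc_vertex uv pe) => ->.
  by apply: (nST w) => //; case: (edge_arc_vertex u'v' pe') => ->.
Qed.

Lemma edge_arc_compact u v : adj G u v -> compact (edge_arc u v).
Proof.
move=> /edge_arc_is_arc[f [cf _ _ _ <-]].
exact/continuous_compact/segment_compact.
Qed.

Lemma edge_arc_connected u v : adj G u v -> connected (edge_arc u v).
Proof.
move=> /edge_arc_is_arc[f [cf _ _ _ <-]].
exact/connected_continuous_connected/cf/segment_connected.
Qed.

Lemma edge_arc_source u v : adj G u v -> edge_arc u v (pos u).
Proof.
by move=> /edge_arc_is_arc[f [cf _ <- _ <-]]; exists 0; rewrite //= in_itv /= lexx ler01.
Qed.

Lemma edge_arc_target u v : adj G u v -> edge_arc u v (pos v).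
Proof.
by move=> /edge_arc_is_arc[f [cf _ _ <- <-]]; exists 1; rewrite //= in_itv /= lexx ler01.
Qed.

Lemma subdrawing_compact S : compact (subdrawing S).
Proof.
have fin (I : finType) (P : pred I) (F : I -> set (R * R)) :
    (forall i, P i -> compact (F i)) -> compact (\bigcup_(i in [set i | P i]) F i).
  move=> cF; rewrite (_ : [set i | P i] = [set i | (i \in enum I) && P i]).
    by rewrite bigcup_seq_cond; apply: bigsetU_compact.
  by apply/seteqP; split=> i /=; rewrite mem_enum inE.
have -> : subdrawing S = \bigcup_(v in [set v | v \in S]) [set pos v] `|`
    \bigcup_(e in [set e | [&& e.1 \in S, e.2 \in S & adj G e.1 e.2]]) edge_arc e.1 e.2.
  apply/seteqP; split=> p.
    case=> [[v vS ->]|[u [v [uS vS uv pe]]]]; first by left; exists v.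
    by right; exists (u, v) => //=; rewrite uS vS.
  case=> [[v vS ->]|[[u v] /= /and3P[uS vS uv] pe]]; first by left; exists v.
  by right; exists u, v.
apply: compactU; apply: fin; first by move=> v _; exact: compact_set1.
by move=> [u v] /and3P[_ _ uv]; exact: edge_arc_compact.
Qed.

Lemma subdrawing_connected S : conn_set (adj G) S -> connected (subdrawing S).
Proof.
move=> /conn_setP[[v0 v0S] conS]; pose C := connected_component (subdrawing S).
have arcC u v p q : u \in S -> v \in S -> adj G u v -> edge_arc u v p ->
    edge_arc u v q -> C p q.
  move=> uS vS uv pe qe; apply: (@connected_component_max _ _ (edge_arc u v)) => //.
    by move=> z ze; right; exists u, v.
  exact: edge_arc_connected.
have posC v : v \in S -> C (pos v0) (pos v).
  move=> vS; have /connectP[s + ->] := conS _ _ v0S vS.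
  have : C (pos v0) (pos v0) by apply: connected_component_refl; left; exists v0.
  elim: s {2 3 5}v0 => //= w s IHs u Cu /andP[/and3P[uS wS uw]]; apply: IHs.
  apply: connected_component_trans Cu _.
  by apply: (arcC u w) => //; [exact: edge_arc_source|exact: edge_arc_target].
suff -> : subdrawing S = C (pos v0) by exact: component_connected.
apply/seteqP; split; last exact: connected_component_sub.
move=> p [[v vS ->]|[u [v [uS vS uv pe]]]]; first exact: posC.
apply: connected_component_trans (posC _ uS) _.
by apply: (arcC u v) => //; exact: edge_arc_source.
Qed.

(** [z] acts as an additional vertex far out, the same for all [v]. The continuum has to avoid only
    what the other vertices span: it leaves [pos v] inside a ball missing that drawing, continues in
    the outer face and ends far away. *)
Lemma outer_continuum : exists z, forall v F, is_outer_face G F -> incident v F ->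
  exists C, [/\ compact C, connected C, C z, C (pos v)
              & forall S, v \notin S -> C `&` subdrawing S = set0].
Proof.
have cD : compact (drawing G) by rewrite -subdrawing_setT; exact: subdrawing_compact.
have [M [_ DM]] := compact_bounded cD.
pose m := `|M| + 1.
have m0 : 0 <= m by rewrite addr_ge0.
have {}DM x : m < `|x| -> (~` drawing G) x.
  move=> mx Dx; have := DM m; rewrite (le_lt_trans (ler_norm M)) ?ltrDl // => /(_ isT x Dx) /=.
  by rewrite leNgt mx.
exists (m + 1, m + 1) => v F [[x Ux FE] unb] [clF _].
have oU : open (~` drawing G) by rewrite openC; apply: compact_closed cD; exact: norm_hausdorff.
pose D' := subdrawing (~: [set v]%SET).
have cD' : compact D' by exact: subdrawing_compact.
(* An unbounded face reaches beyond the bound [m] of the drawing; from [y] on, [joined_far] takes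
   over. *)
have [y Fy my] : exists2 y, F y & m < `|y|.
  apply: contrapT => ny; apply: unb; exists m; split; first by rewrite num_real.
  move=> k mk y Fy; apply: le_trans (ltW mk); rewrite leNgt; apply/negP => my.
  by apply: ny; exists y.
have UD' : ~` drawing G `<=` ~` D'.
  by apply: subsetC; rewrite -subdrawing_setT; apply: subdrawing_mono; exact: finset.subsetT.
have mono p q : joined (~` drawing G) p q -> joined (~` D') p q.
  by move=> [C [? ? CU ? ?]]; exists C; split=> //; exact: subset_trans CU UD'.
have nv : nbhs (pos v) (~` D').
  apply: open_nbhs_nbhs; split.
    by rewrite openC; apply: compact_closed cD'; exact: norm_hausdorff.
  move=> D'v; have : (D' `&` subdrawing [set v]%SET) (pos v).
    by split=> //; left; exists v => //; rewrite inE.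
  by rewrite subdrawing_disjoint // finset.disjoints_subset.
have /nbhs_ballP[r /= r0 rD'] := nv.
have [w [Fw vw]] := clF _ (nbhsx_ballx (pos v) r r0).
have [C [kC cC CD' Cv Cz]] : joined (~` D') (pos v) (m + 1, m + 1).
  apply: joined_trans (joined_ball rD' vw) _; apply: mono.
  apply: (@joined_trans _ _ _ y); last exact: joined_far.
  by rewrite FE in Fw Fy; exact: joined_component oU Fw Fy.
exists C; split=> // S vS; apply/seteqP; split=> // p [/CD' nD' Sp]; apply: nD'.
by apply: subdrawing_mono Sp; rewrite finset.subsetC finset.sub1set inE.
Qed.

(** The point [z] of [outer_continuum] is a third vertex beside the two sets [A i], which completes
    a K_{3,3}. The edge between [A i] and [B j] is the entire drawing of their union. *)
Lemma no_outer_K23 (A : 'I_2 -> {set vertex G}) (B : 'I_3 -> {set vertex G}) :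
    (forall i, conn_set (adj G) (A i)) -> (forall j, conn_set (adj G) (B j)) ->
    [disjoint A 0 & A 1]%B -> (forall j l, j != l -> [disjoint B j & B l]%B) ->
    (forall i j, touch (adj G) (A i) (B j)) -> (forall j, meets_outer (B j)) ->
  False.
Proof.
move=> conA conB dA dB tAB outB.
have [z zP] := outer_continuum.
have /choice[f fP] : forall j, exists vC : vertex G * set (R * R),
    [/\ vC.1 \in B j, compact vC.2, connected vC.2 & vC.2 z /\ vC.2 (pos vC.1)] /\
    forall S, vC.1 \notin S -> vC.2 `&` subdrawing S = set0.
  move=> j; have [F outF [v vB vF]] := outB j.
  by have [C [? ? ? ? ?]] := zP v F outF vF; exists (v, C).
have /choice[a aA] : forall i, exists v, v \in A i by move=> i; have /conn_setP[] := conA i.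
(* [insub] sends the indices 0 and 1 to the sets [A]; the index 2 stands for [z]. *)
pose E (i j : 'I_3) := if insub (val i) is Some i' then subdrawing (A i' :|: B j) else (f j).2.
pose p (i : 'I_3) := if insub (val i) is Some i' then pos (a i') else z.
have conAB i j : conn_set (adj G) (A i :|: B j).
  apply: conn_setU => //; first exact: adj_sym.
  have /andP[_ /exists_inP[u uA /exists_inP[v vB uv]]] := tAB i j.
  by exists u, v; split=> //; rewrite uv orbT.
have dAB i j : [disjoint A i & B j]%B by have /andP[] := tAB i j.
apply: (@no_continua_K33 _ p (fun j => pos (f j).1) E).
- move=> i j; rewrite /E; case: insubP => [i' _ _|_]; first exact: subdrawing_compact.
  by have [[]] := fP j.
- move=> i j; rewrite /E; case: insubP => [i' _ _|_]; first exact: subdrawing_connected.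
  by have [[]] := fP j.
- move=> i j; rewrite /E /p; case: insubP => [i' _ _|_]; last by have [[_ _ _ []]] := fP j.
  by left; exists (a i') => //; rewrite inE aA.
- move=> i j; have [[vB _ _ []]] := fP j; rewrite /E; case: insubP => [i' _ _ _ _|//].
  by left; exists (f j).1 => //; rewrite inE vB orbT.
move=> i j k l ik jl.
have outD i' j' l' : j' != l' -> (f j').2 `&` subdrawing (A i' :|: B l') = set0.
  move=> j'l'; have [[vB _ _ _]] := fP j'; apply; rewrite inE negb_or.
  by rewrite (disjointFl (dAB i' j') vB) (disjointFr (dB _ _ j'l') vB).
rewrite /E; case: insubP => [i' _ ei|ni]; case: insubP => [k' _ ek|nk].
- have i'k' : i' != k' by apply: contra ik => /eqP ii; rewrite -val_eqE /= -ei -ek ii.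
  have dA' : [disjoint A i' & A k']%B.
    by case: i' k' i'k' {ei ek} => [[|[|//]] hi] [[|[|//]] hk] // _;
      [|rewrite disjoint_sym]; move: dA; congr (is_true [disjoint A _ & A _]%B); apply: val_inj.
  apply: subdrawing_disjoint.
  rewrite finset.disjoints_subset finset.setCU finset.subsetI !finset.subUset.
  by rewrite -!finset.disjoints_subset dA' dAB (disjoint_sym (B j)) dAB dB.
- by rewrite setIC outD // eq_sym.
- exact: outD.
- case/negP: ik; rewrite -val_eqE /=; move: ni nk.
  by case: i k => [[|[|[|//]]] ?] [[|[|[|//]]] ?].
Qed.

End Subdrawings.

(** * Distances and breadth-first search *)

Section GraphDistance.
Variables (T : finType) (r : rel T).

Lemma dist_leW m n x y : m <= n -> dist_le r m x y -> dist_le r n x y.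
Proof. by move=> mn [p [? ? pm]]; exists p; split=> //; exact: leq_trans mn. Qed.

Lemma dist_le_trans m n x y z :
  dist_le r m x y -> dist_le r n y z -> dist_le r (m + n) x z.
Proof.
move=> [p [xp <- pm]] [q [pq <- qn]]; exists (p ++ q).
by rewrite cat_path xp pq last_cat size_cat leq_add.
Qed.

Lemma dist_le_sym n x y : symmetric r -> dist_le r n x y -> dist_le r n y x.
Proof.
move=> rsym [p [xp <- pn]]; exists (rev (belast x p)).
rewrite size_rev size_belast; split=> //.
  by rewrite rev_path; apply: sub_path xp => u v; rewrite rsym.
by case: p {xp pn} => //= z p; rewrite rev_cons last_rcons.
Qed.

(** [d] is the distance from the canonical root of each component; the last clause takes the vertex
    before [x] on a shortest path from there. *)
Lemma bfs_depth : symmetric r -> exists d : T -> nat,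
  [/\ forall x, (d x == 0) = (fingraph.root r x == x),
      forall x y, r x y -> d y <= (d x).+1
    & forall x n, d x = n.+1 -> exists2 y, r x y & d y = n].
Proof.
move=> rsym; have csym := sym_connect_sym rsym.
pose P x n := `[< exists p, [/\ path r (fingraph.root r x) p,
  last (fingraph.root r x) p = x & size p = n] >].
have exP x : exists n, P x n.
  have : connect r (fingraph.root r x) x by rewrite csym connect_root.
  by case/connectP=> p rp xp; exists (size p); apply/asboolP; exists p.
pose d x := ex_minn (exP x).
have dP x : exists p, [/\ path r (fingraph.root r x) p,
    last (fingraph.root r x) p = x & size p = d x].
  by rewrite /d; case: ex_minnP => n /asboolP.
have dmin x p : path r (fingraph.root r x) p -> last (fingraph.root r x) p = x ->
    d x <= size p.
  by rewrite /d; case: ex_minnP => n _ nmin rp xp; apply/nmin/asboolP; exists p.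
have step x y : r x y -> d y <= (d x).+1.
  move=> xy; have [p [rp xp <-]] := dP x.
  have rE : fingraph.root r y = fingraph.root r x.
    by apply/esym/(fingraph.rootP csym); exact: connect1.
  by rewrite -(size_rcons p y); apply: dmin; rewrite rE ?last_rcons // rcons_path rp xp.
exists d; split=> //.
  move=> x; apply/eqP/eqP => [d0|rx].
    by have [p [_ xp /eqP]] := dP x; rewrite d0 size_eq0 => /eqP p0; rewrite -[RHS]xp p0.
  by apply/eqP; rewrite -leqn0 -[0]/(size ([::] : seq T)); apply: dmin.
move=> x n dx; have [p [rp xp sp]] := dP x.
case/lastP: p => [|p z] in rp xp sp; first by rewrite dx in sp.
move: rp xp sp; rewrite rcons_path last_rcons size_rcons dx => /andP[rp yz] zx [sp].
rewrite {}zx in yz; exists (last (fingraph.root r x) p); first by rewrite rsym.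
apply/eqP; rewrite eqn_leq; apply/andP; split; last by rewrite -ltnS -dx step.
rewrite -sp; set y := last _ p.
have rE : fingraph.root r y = fingraph.root r x.
  by apply/(fingraph.rootP csym); exact: connect1.
by apply: dmin; rewrite rE.
Qed.

End GraphDistance.

(** * Components of induced subgraphs *)

Section Components.
Variables (V : finType) (e : rel V).
Hypothesis e_sym : symmetric e.
Implicit Types (A S P : {set V}).

Definition induced A : rel V := [rel x y | [&& x \in A, y \in A & e x y]].

Lemma induced_sym A : symmetric (induced A).
Proof. by move=> x y; rewrite /induced /= e_sym andbCA. Qed.

Lemma connect_inducedS A S x y :
  A \subset S -> connect (induced A) x y -> connect (induced S) x y.
Proof.
move=> /fintype.subsetP AS; apply: connect_rel_mono => u v /and3P[uA vA uv].
by rewrite /induced /= uv !AS.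
Qed.

(** For [x] outside [A] no step is possible and this is the singleton of [x], so it is nonempty and
    connected in every case. *)
Definition component_of A x : {set V} := [set y | connect (induced A) x y].

Lemma component_of_refl A x : x \in component_of A x.
Proof. by rewrite inE connect0. Qed.

Lemma component_of_sub A x : x \in A -> component_of A x \subset A.
Proof.
move=> xA; apply/fintype.subsetP => y; rewrite inE => /connectP[p + ->].
by elim: p x xA => //= z p IHp x xA /andP[/and3P[_ zA _]]; exact: IHp.
Qed.

Lemma component_of_conn A x : conn_set e (component_of A x).
Proof.
apply/conn_setP; split; first by exists x; exact: component_of_refl.
suff con y : y \in component_of A x -> connect (induced (component_of A x)) x y.
  move=> y z yC zC; apply: connect_trans (con z zC).
  by rewrite (sym_connect_sym (induced_sym _)) con.
rewrite inE => /connectP[p + ->].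
elim: p {1 3 5 6}x (component_of_refl A x) => //= z p IHp w wC /andP[wz zp].
have zC : z \in component_of A x.
  by move: wC; rewrite !inE => xw; apply: connect_trans xw (connect1 wz).
apply: connect_trans (IHp z zC zp); apply: connect1.
by case/and3P: wz => _ _ wz; rewrite /induced /= wC zC.
Qed.

Lemma component_of_eq A x y : y \in component_of A x -> component_of A y = component_of A x.
Proof.
rewrite inE => xy; apply/setP => z; rewrite !inE.
by rewrite (same_connect (sym_connect_sym (induced_sym A)) xy).
Qed.

Lemma conn_component_of A S x y :
  conn_set e S -> S \subset A -> x \in S -> y \in S -> y \in component_of A x.
Proof.
move=> /conn_setP[_ conS] SA xS yS; rewrite inE.
exact: connect_inducedS SA (conS x y xS yS).
Qed.

(** This is the edge by which a path in [S] from [x] to [w] first leaves [P]. *)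
Lemma exit_edge S P x w : conn_set e S -> x \in S -> w \in S ->
  x \in P -> w \notin P ->
  exists u v, [/\ u \in component_of (S :&: P) x, u \in S :&: P, v \in S, v \notin P & e u v].
Proof.
move=> /conn_setP[_ conS] xS wS; have /connectP[p + ->] := conS x w xS wS.
elim: p x xS => [|z p IHp] x xS /=; first by move=> _ ->.
case/andP=> /and3P[_ zS xz] zp xP wP; have [zP|zP] := boolP (z \in P).
  have [u [v [uC uSP vS vP uv]]] := IHp z zS zp zP wP; exists u, v; split=> //.
  rewrite -(@component_of_eq _ x z) //.
  by rewrite inE connect1 // /induced /= !inE xS xP zS zP.
by exists x, z; rewrite component_of_refl inE xS xP.
Qed.

End Components.

(** * Depth layers, with planarity expressed by the exclusion of K_{2,3} *)

Section Layers.
Variables (V : finType) (e : rel V) (outer : {set V} -> Prop) (Hs : {set {set V}}).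
Implicit Types (A B S : {set V}) (H : {set V}).
Hypothesis e_sym : symmetric e.
Hypothesis outerS : forall A B, A \subset B -> outer A -> outer B.
Hypothesis no_K23 : forall (A : 'I_2 -> {set V}) (B : 'I_3 -> {set V}),
  (forall i, conn_set e (A i)) -> (forall j, conn_set e (B j)) ->
  [disjoint A ord0 & A ord_max] -> (forall j l, j != l -> [disjoint B j & B l]) ->
  (forall i j, touch e (A i) (B j)) -> (forall j, outer (B j)) -> False.
Hypothesis Hs_conn : forall H, H \in Hs -> conn_set e H.
Hypothesis Hs_spans : spans e Hs.
Hypothesis Hs_outer : forall H, H \in Hs -> outer H.
Hypothesis uncovered_outer : forall v, v \notin finset.cover Hs -> outer [set v].

Lemma rig_sym : symmetric (rig Hs).
Proof. by move=> X Y; rewrite /rig /= andbCA (eq_sym X) (disjoint_sym X). Qed.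

Lemma rigP X Y : rig Hs X Y -> [/\ X \in Hs, Y \in Hs & exists v, v \in X /\ v \in Y].
Proof. by case/and4P=> XH YH _ /pred0Pn[v /andP[vX vY]]; split=> //; exists v. Qed.

Lemma share_dist_le X Y v :
  X \in Hs -> Y \in Hs -> v \in X -> v \in Y -> dist_le (rig Hs) 1 X Y.
Proof.
move=> XH YH vX vY; have [<-|XY] := eqVneq X Y; first by exists [::].
exists [:: Y]; split=> //; rewrite /rig /= XH YH XY andbT /=.
by apply/pred0Pn; exists v; rewrite /= vX vY.
Qed.

Lemma dist_le_connect n X Y : dist_le (rig Hs) n X Y -> connect (rig Hs) X Y.
Proof. by move=> [p [Xp <- _]]; apply/connectP; exists p. Qed.

Lemma connect_rig X Y x y : X \in Hs -> Y \in Hs -> x \in X -> y \in Y ->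
  connect e x y -> connect (rig Hs) X Y.
Proof.
move=> + YH + yY /connectP[p + yE]; rewrite {}yE in yY *.
elim: p x X yY => [|z p IHp] x X /= yY XH xX.
  by move=> _; exact: dist_le_connect (share_dist_le XH YH xX yY).
case/andP=> xz zp; have [Z ZH /andP[xZ zZ]] := Hs_spans xz.
apply: connect_trans (IHp z Z yY ZH zZ zp).
exact: dist_le_connect (share_dist_le XH ZH xX xZ).
Qed.

(** Walking through [Y], one leaves the vertices covered by one ball along an edge. A member
    containing this edge lies in the other ball and meets the first, so the passage costs 1 and each
    ball at most [n + n]. *)
Lemma two_balls_diam n Y c1 c2 : conn_set e Y ->
  (forall H, H \in meeting Hs Y -> dist_le (rig Hs) n c1 H \/ dist_le (rig Hs) n c2 H) ->
  weak_diam_le (rig Hs) ((n + n + 1) + (n + n)) (meeting Hs Y).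
Proof.
move=> conY cov.
have same c a b : dist_le (rig Hs) n c a -> dist_le (rig Hs) n c b ->
    dist_le (rig Hs) (n + n) a b.
  by move=> ca cb; apply: dist_le_trans cb; exact: dist_le_sym rig_sym ca.
suff cross c c' a b : (forall H, H \in meeting Hs Y ->
      dist_le (rig Hs) n c H \/ dist_le (rig Hs) n c' H) ->
    a \in meeting Hs Y -> b \in meeting Hs Y ->
    dist_le (rig Hs) n c a -> dist_le (rig Hs) n c' b ->
    dist_le (rig Hs) ((n + n + 1) + (n + n)) a b.
  move=> a b aY bY; have [ca|ca] := cov a aY; have [cb|cb] := cov b bY.
  - by apply: dist_leW (same _ _ _ ca cb); clear; lia.
  - exact: (cross c1 c2).
  - by apply: (cross c2 c1) => // H /cov[]; [right|left].
  - by apply: dist_leW (same _ _ _ ca cb); clear; lia.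
move=> {}cov; rewrite !inE => /andP[aH /pred0Pn[x /andP[/= xa xY]]].
move=> /andP[bH /pred0Pn[y /andP[/= yb yY]]] ca cb.
pose N := [set u | `[< exists H, [/\ H \in Hs, u \in H & dist_le (rig Hs) n c H] >]].
have xN : x \in N by rewrite inE; apply/asboolP; exists a.
have [|yN] := boolP (y \in N).
  rewrite inE => /asboolP[H [HH yH cH]].
  have := dist_le_trans (same _ _ _ ca cH) (share_dist_le HH bH yH yb).
  by apply: dist_leW; clear; lia.
have [u [v [_ + vY vN uv]]] := exit_edge e_sym conY xY yY xN yN.
rewrite inE => /andP[uY]; rewrite inE => /asboolP[H [HH uH cH]].
(* [Z] contains [v], which is outside [N], so it must be near [c']. *)
have [Z ZH /andP[uZ vZ]] := Hs_spans uv.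
have [cZ|cZ] : dist_le (rig Hs) n c Z \/ dist_le (rig Hs) n c' Z.
- by apply: cov; rewrite inE ZH; apply/pred0Pn; exists v; rewrite /= vZ vY.
- by case/negP: vN; rewrite inE; apply/asboolP; exists Z.
apply: dist_le_trans (same _ _ _ cZ cb).
exact: dist_le_trans (same _ _ _ ca cH) (share_dist_le HH ZH uH uZ).
Qed.

(** * Members attached to a component of deep vertices *)

Variables (d : {set V} -> nat) (dv : V -> nat).
Hypothesis d_eq0 : forall H, (d H == 0) = (fingraph.root (rig Hs) H == H).
Hypothesis d_pred : forall H n, d H = n.+1 -> exists2 H', rig Hs H H' & d H' = n.
Hypothesis dv_attained :
  forall v, v \in finset.cover Hs -> exists H, [/\ H \in Hs, v \in H & d H = dv v].
Hypothesis dv_bounds : forall H v, H \in Hs -> v \in H -> dv v <= d H <= (dv v).+1.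

Let above k := [set v | k < dv v].

Lemma in_cover H v : H \in Hs -> v \in H -> v \in finset.cover Hs.
Proof. by move=> HH vH; apply/bigcupP; exists H. Qed.

Lemma same_root H H' : connect (rig Hs) H H' ->
  fingraph.root (rig Hs) H = fingraph.root (rig Hs) H'.
Proof. by move=> HH'; apply/(fingraph.rootP (sym_connect_sym rig_sym)). Qed.

Definition attached k (X : {set V}) H : Prop :=
  [/\ H \in Hs, d H = k & exists b x, [/\ b \in H, x \in X & e x b]].

(** A member deeper than [k + 1] lies inside [above k], so its predecessor meets the same component.
    A member of depth [k + 1] leaves the component by an edge whose far end has [dv] equal to
    [k]. *)
Lemma attached_near k v n H x : d H = k + n.+1 -> H \in Hs -> x \in H ->
  x \in component_of e (above k) v -> x \in above k ->
  exists2 H', attached k (component_of e (above k) v) H' & dist_le (rig Hs) n.+1 H H'.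
Proof.
elim: n H x => [|n IHn] H x dH HH xH xX xk.
  have [H' /rigP[_ H'H [w [wH wH']]] dH'] := d_pred (etrans dH (addn1 k)).
  have wk : w \notin above k by rewrite inE -leqNgt -dH'; case/andP: (dv_bounds H'H wH').
  have [u [b [uC _ bH bk ub]]] := exit_edge e_sym (Hs_conn HH) xH wH xk wk.
  have dvb : dv b = k by move: bk (dv_bounds HH bH); rewrite inE dH; clear; lia.
  have [H'' [H''H bH'' dH'']] := dv_attained (in_cover HH bH).
  exists H''; last exact: share_dist_le HH H''H bH bH''.
  split=> //; first by rewrite dH''.
  exists b, u; split=> //; rewrite -(component_of_eq e_sym xX).
  by move: uC; rewrite !inE; apply: connect_inducedS; exact: subsetIr.
have [H' /[dup] HrH' /rigP[_ H'H [w [wH wH']]] dH'] := d_pred (etrans dH (addnS k _)).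
have Hk : H \subset above k.
  by apply/fintype.subsetP => y yH; rewrite inE; move: (dv_bounds HH yH); rewrite dH; clear; lia.
have wX : w \in component_of e (above k) v.
  by rewrite -(component_of_eq e_sym xX); exact: conn_component_of (Hs_conn HH) Hk xH wH.
have [H'' att dist] := IHn H' w dH' H'H wH' wX (fintype.subsetP Hk _ wH).
exists H'' => //; rewrite -[n.+2]add1n; apply: dist_le_trans dist.
by exists [:: H'] => //=; rewrite HrH'.
Qed.

Lemma attached_root k v H H' : v \in above k ->
  attached k (component_of e (above k) v) H -> attached k (component_of e (above k) v) H' ->
  fingraph.root (rig Hs) H = fingraph.root (rig Hs) H'.
Proof.
move=> vk [HH _ [b [x [bH xX xb]]]] [H'H _ [b' [x' [b'H x'X xb']]]].
apply: same_root; apply: connect_rig HH H'H bH b'H _.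
have toe y z : y \in component_of e (above k) v -> z \in component_of e (above k) v ->
    connect e y z.
  move=> yX zX; rewrite -(component_of_eq e_sym yX) inE in zX.
  by apply: connect_rel_mono zX => u w /and3P[].
apply: (@connect_trans _ _ x); first by apply: connect1; rewrite e_sym.
by apply: (@connect_trans _ _ x'); [exact: toe|exact: connect1].
Qed.

(** The predecessors leading back to the root member have depth at most [k], hence only vertices
    with [dv] at most [k]. *)
Lemma low_connected k r0 h0 H y : r0 \in Hs -> h0 \in r0 -> H \in Hs -> d H <= k ->
  fingraph.root (rig Hs) H = r0 -> y \in H -> y \in component_of e [set v | dv v <= k] h0.
Proof.
move=> r0H h0r; move dH : (d H) => n.
have low H' : H' \in Hs -> d H' <= k -> H' \subset [set v | dv v <= k].
  by move=> H'H dk; apply/fintype.subsetP => z /(dv_bounds H'H); rewrite inE; move: dk; clear; lia.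
elim: n H dH y => [|n IHn] H dH y HH nk rH yH.
  have HE : H = r0 by apply/eqP; rewrite -rH eq_sym -d_eq0 dH.
  by apply: conn_component_of yH; rewrite ?HE //; [exact: Hs_conn|apply: low; rewrite -?HE ?dH].
have [H' HH' dH'] := d_pred dH.
have [_ H'H [w [wH wH']]] := rigP HH'.
have wC : w \in component_of e [set v | dv v <= k] h0.
  apply: (IHn H') => //; first exact: ltnW.
  by rewrite -rH; apply/esym/same_root; exact: connect1.
by rewrite -(component_of_eq e_sym wC); apply: conn_component_of yH;
  [exact: Hs_conn|apply: low; rewrite ?dH|].
Qed.

(** [no_K23] is applied to the deep component, the low component around the root, and three members
    extended down to the latter. The descent uses two smaller depths, hence the exclusion of depth
    1. *)
Lemma no_three_attached k v (H : 'I_3 -> {set V}) : k != 1 -> v \in above k ->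
  (forall i, attached k (component_of e (above k) v) (H i)) ->
  exists i j, i != j /\ dist_le (rig Hs) 3 (H i) (H j).
Proof.
move=> k1 vk att.
have rt i j := attached_root vk (att i) (att j).
(* At depth 0 all attached members are the common root. Otherwise their depth is written [k.+2] from
   here on. *)
case: k k1 => [|[//|k]] _ in vk att rt *.
  exists ord0, ord_max; split=> //; exists [::]; split=> //=.
  have E i : fingraph.root (rig Hs) (H i) = H i.
    by have [_ dH _] := att i; apply/eqP; rewrite -d_eq0 dH.
  by rewrite -(E ord0) -(E ord_max).
apply: contrapT => nclose.
set X := component_of e (above k.+2) v in att.
have Xk : X \subset above k.+2 by exact: component_of_sub.
pose r0 := fingraph.root (rig Hs) (H ord0).
have HH i : H i \in Hs by have [] := att i.
have r0H : r0 \in Hs.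
  have : connect (rig Hs) (H ord0) r0 by exact: connect_root.
  case/connectP=> p pP ->; elim: p (H ord0) (HH ord0) pP => //= Z p IHp W WH.
  by case/andP=> /rigP[_ ZH _]; exact: IHp.
have /conn_setP[[h0 h0r] _] := Hs_conn r0H.
have h00 : dv h0 = 0.
  have : d r0 == 0 by rewrite d_eq0 (root_root (sym_connect_sym rig_sym)).
  by move/eqP => dr0; move: (dv_bounds r0H h0r); rewrite dr0; clear; lia.
pose A2 := component_of e [set u | dv u <= k] h0.
have A2k : A2 \subset [set u | dv u <= k] by apply: component_of_sub; rewrite inE h00.
(* [HC i] pairs a predecessor of [H i] with a component of its part deeper than [k]; this component
   meets [H i] and is joined to [A2] by an edge. *)
have /choice[HC HCP] : forall i, exists HC : {set V} * {set V},
    [/\ HC.1 \in Hs, dist_le (rig Hs) 1 (H i) HC.1,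
        HC.2 \subset [set u in HC.1 | k < dv u <= k.+1], conn_set e HC.2
      & (exists2 z, z \in H i & z \in HC.2) /\
        (exists u w, [/\ u \in A2, w \in HC.2 & e u w])].
  move=> i; have [_ dHi _] := att i.
  have [H' HH' dH'] := d_pred dHi; have [H'' H'H'' dH''] := d_pred dH'.
  have [_ H'H [z [zH zH']]] := rigP HH'; have [_ H''H [w [wH' wH'']]] := rigP H'H''.
  have zk : z \in above k by rewrite inE; move: (dv_bounds (HH i) zH); rewrite dHi; clear; lia.
  have wk : w \notin above k by rewrite inE; move: (dv_bounds H''H wH''); rewrite dH''; clear; lia.
  have [u [b [uC uHk bH' bk ub]]] := exit_edge e_sym (Hs_conn H'H) zH' wH' zk wk.
  exists (H', component_of e (H' :&: above k) z); split=> //=.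
  - exact: share_dist_le (HH i) H'H zH zH'.
  - have zHk : z \in H' :&: above k by rewrite inE zH'.
    have /fintype.subsetP sub := component_of_sub e zHk.
    apply/fintype.subsetP => y /sub; rewrite !inE => /andP[yH' yk].
    by rewrite yH' yk; move: (dv_bounds H'H yH'); rewrite dH'; clear; lia.
  - exact: component_of_conn.
  split; first by exists z => //; exact: component_of_refl.
  exists b, u; rewrite e_sym; split=> //.
  have [Z [ZH bZ dZ]] := dv_attained (in_cover H'H bH').
  apply: (low_connected r0H h0r ZH _ _ bZ).
    by rewrite dZ leqNgt; move: bk; rewrite inE.
  rewrite /r0 (rt ord0 i); apply/esym/same_root.
  apply: connect_trans (connect1 HH') _.
  exact: dist_le_connect (share_dist_le H'H ZH bH' bZ).
pose B i := H i :|: (HC i).2.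
have Bk i u : u \in B i -> k < dv u <= k.+2.
  have [H'H _ /fintype.subsetP HCk _ _] := HCP i; have [_ dHi _] := att i.
  rewrite inE => /orP[uH|/HCk]; first by move: (dv_bounds (HH i) uH); rewrite dHi; clear; lia.
  by rewrite inE => /andP[_]; clear; lia.
have disj A A' (P P' : pred nat) : (forall n, P n -> P' n -> False) ->
    (forall u, u \in A -> P (dv u)) -> (forall u, u \in A' -> P' (dv u)) ->
    [disjoint A & A'].
  move=> PP AP AP'; apply/pred0P => u /=; apply/negP => /andP[/AP Pu /AP' P'u].
  exact: PP Pu P'u.
have XP u : u \in X -> k.+2 < dv u by move/(fintype.subsetP Xk); rewrite inE.
have A2P u : u \in A2 -> dv u <= k by move/(fintype.subsetP A2k); rewrite inE.
apply: (@no_K23 (fun i : 'I_2 => if i == ord0 then X else A2) B).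
- by move=> i; case: ifP => _; exact: component_of_conn.
- move=> j; have [_ _ _ conC [[z zH zC] _]] := HCP j.
  by apply: conn_setU => //; [exact: Hs_conn|exists z, z; rewrite eqxx].
- by apply: (disj _ _ (fun n => k.+2 < n) (fun n => n <= k)) => // n; clear; lia.
- move=> i j ij; apply/pred0P => u /=; apply/negP => /andP[ui uj].
  have near l : u \in B l -> exists H', [/\ H' \in Hs, u \in H' & dist_le (rig Hs) 1 (H l) H'].
    have [H'H dist /fintype.subsetP HCk _ _] := HCP l.
    rewrite inE => /orP[uH|/HCk]; first by exists (H l); split=> //; exists [::].
    by rewrite inE => /andP[uH' _]; exists (HC l).1.
  have [Hi [HiH uHi disti]] := near i ui; have [Hj [HjH uHj distj]] := near j uj.
  (* One step leads from [H i] to a member containing [u], one passes through [u], and one leads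
     back to [H j]: hence the 3. *)
  apply: nclose; exists i, j; split=> //.
  apply: (@dist_le_trans _ _ 2 1 _ Hj); last exact: dist_le_sym rig_sym distj.
  by apply: (@dist_le_trans _ _ 1 1 _ Hi) => //; exact: share_dist_le HiH HjH uHi uHj.
- move=> i j; case: ifP => _; apply/andP; split.
  + by apply: (disj _ _ (fun n => k.+2 < n) (fun n => k < n <= k.+2)) => //; [clear; lia|exact: Bk].
  + have [_ _ [b [x [bH xX xb]]]] := att j; apply/exists_inP; exists x => //.
    by apply/exists_inP; exists b => //; rewrite inE bH.
  + by apply: (disj _ _ (fun n => n <= k) (fun n => k < n <= k.+2)) => //; [clear; lia|exact: Bk].
  + have [_ _ _ _ [_ [u [w [uA wC uw]]]]] := HCP j; apply/exists_inP; exists u => //.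
    by apply/exists_inP; exists w => //; rewrite inE wC orbT.
- by move=> j; apply: outerS (Hs_outer (HH j)); exact: finset.subsetUl.
Qed.

(** An attached member farther than 3 from [c1] becomes the second centre, and a third one far from
    both would contradict [no_three_attached]. If there is none, [c1] serves twice. *)
Lemma attached_two_balls k v : k != 1 -> v \in above k ->
  exists c1 c2, forall H, attached k (component_of e (above k) v) H ->
    dist_le (rig Hs) 3 c1 H \/ dist_le (rig Hs) 3 c2 H.
Proof.
move=> k1 vk; set att := attached k _.
have [[c1 att1]|none] := pselect (exists c, att c); last first.
  by exists finset.set0, finset.set0 => H attH; case: none; exists H.
have [[c2 [att2 far]]|close] := pselect (exists c, att c /\ ~ dist_le (rig Hs) 3 c1 c).
  exists c1, c2 => H attH; pose F (i : 'I_3) := nth H [:: c1; c2] i.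
  have [|i [j [ij Fij]]] := @no_three_attached k v F k1 vk.
    by rewrite /F => -[[|[|[|//]]] ?].
  have {ij}Fij : [\/ dist_le (rig Hs) 3 c1 c2, dist_le (rig Hs) 3 c1 H
                | dist_le (rig Hs) 3 c2 H].
    case: i j ij Fij => [[|[|[|//]]] hi] [[|[|[|//]]] hj] //= _; rewrite /F /= => Fij;
      (have Fji := dist_le_sym rig_sym Fij); by [constructor 1|constructor 2|constructor 3].
  by case: Fij => [/far//|?|?]; [left|right].
exists c1, c1 => H attH; left; apply: contrapT => far.
by apply: close; exists H.
Qed.

(** * Pieces: components of groups of consecutive depths *)

Hypothesis dv_uncovered : forall v, v \notin finset.cover Hs -> dv v = 0.

(** For positive [j], level [j] comprises the values [2j - 1] and [2j], which are those possible in
    a member of depth [2j]. *)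
Definition lev v := (dv v).+1 %/ 2.

Definition piece v := component_of e [set u | lev u == lev v] v.

Lemma piece_lev u v : u \in piece v -> lev u = lev v.
Proof.
have vL : v \in [set u | lev u == lev v] by rewrite inE.
by move/(fintype.subsetP (component_of_sub e vL)); rewrite inE => /eqP.
Qed.

Lemma piece_eq u v : u \in piece v -> piece u = piece v.
Proof. by move=> uv; rewrite {1}/piece (piece_lev uv); exact: component_of_eq. Qed.

Lemma mem_piece_conn S u v : conn_set e S -> u \in S -> v \in S ->
  {in S, forall w, lev w = lev v} -> u \in piece v.
Proof.
move=> conS uS vS levS; apply: conn_component_of conS _ vS uS.
by apply/fintype.subsetP => w wS; rewrite inE levS.
Qed.

Lemma piece_diam v : 0 < lev v -> weak_diam_le (rig Hs) 25 (meeting Hs (piece v)).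
Proof.
move=> lv; pose k := (lev v).-1 * 2.
have levk u : lev u = lev v -> k < dv u <= k.+2 by rewrite /k; move: lv; rewrite /lev; clear; lia.
have vk : v \in above k by rewrite inE; case/andP: (levk v erefl).
(* Placeholder *)
have [|c1 [c2 near]] := @attached_two_balls k v _ vk; first by rewrite /k; clear; lia.
apply: (@two_balls_diam 6 _ c1 c2); first exact: component_of_conn.
move=> H; rewrite inE => /andP[HH /pred0Pn[x /andP[/= xH xv]]].
have xk := levk x (piece_lev xv).
have xX : x \in component_of e (above k) v.
  move: xv; rewrite !inE; apply: connect_inducedS; apply/fintype.subsetP => u.
  by rewrite !inE => /eqP/levk/andP[].
have dH : d H = k + (d H - k).-1.+1 by move: (dv_bounds HH xH) xk; clear; lia.
have [|H' att dist] := attached_near dH HH xH xX; first by rewrite inE; case/andP: xk.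
have {}dist : dist_le (rig Hs) 3 H' H.
  by apply: dist_le_sym rig_sym _; apply: dist_leW dist; move: (dv_bounds HH xH) xk; clear; lia.
by case: (near H' att) => c; [left|right]; exact: dist_le_trans c dist.
Qed.

Lemma piece_touch v : 0 < lev v -> exists u, touch e (piece v) (piece u) /\ outer (piece u).
Proof.
move=> lv; pose k := (lev v).-1 * 2.
have [x [xv dvx]] : exists x, x \in piece v /\ dv x = k.+1.
  have : dv v = k.+1 \/ dv v = k.+2 by rewrite /k; move: lv; rewrite /lev; clear; lia.
  case=> dvv; first by exists v; split=> //; exact: component_of_refl.
  have [H [HH vH dH]] : exists H, [/\ H \in Hs, v \in H & d H = dv v].
    by apply: dv_attained; apply/negPn/negP => /dv_uncovered; rewrite dvv.
  have [H' /rigP[_ H'H [x [xH xH']]] dH'] := d_pred (etrans dH dvv).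
  exists x; split.
    apply: (mem_piece_conn (Hs_conn HH)) => // w wH.
    by move: (dv_bounds HH wH); rewrite /lev dH dvv /k; clear; lia.
  by move: (dv_bounds H'H xH') (dv_bounds HH xH); rewrite dH' dH dvv; clear; lia.
have [H [HH xH dH]] : exists H, [/\ H \in Hs, x \in H & d H = dv x].
  by apply: dv_attained; apply/negPn/negP => /dv_uncovered; rewrite dvx.
have [H' /rigP[_ H'H [w [wH wH']]] dH'] := d_pred (etrans dH dvx).
have wk : w \notin above k by rewrite inE; move: (dv_bounds H'H wH'); rewrite dH'; clear; lia.
have xk : x \in above k by rewrite inE dvx.
have [u [b [uC uHk bH bk ub]]] := exit_edge e_sym (Hs_conn HH) xH wH xk wk.
have dvb : dv b = k by move: bk (dv_bounds HH bH); rewrite inE dH dvx; clear; lia.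
have [Z [ZH bZ dZ]] := dv_attained (in_cover HH bH).
have uv : u \in piece v.
  rewrite -(piece_eq xv) /piece inE; move: uC; rewrite inE.
  apply: connect_inducedS; apply/fintype.subsetP => y; rewrite !inE => /andP[yH yk].
  by move: (dv_bounds HH yH) yk; rewrite /lev dH dvx; clear; lia.
exists b; split.
  apply/andP; split; last first.
    apply/exists_inP; exists u => //; apply/exists_inP; exists b => //; exact: component_of_refl.
  apply/pred0P => y /=; apply/negP => /andP[/piece_lev yv /piece_lev].
  by rewrite yv /lev dvb /k; move: lv; rewrite /lev; clear; lia.
apply: outerS (Hs_outer ZH); apply/fintype.subsetP => y yZ.
apply: (mem_piece_conn (Hs_conn ZH)) => // y' y'Z.
by move: (dv_bounds ZH y'Z); rewrite /lev dZ dvb /k; clear; lia.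
Qed.

Lemma piece_lev0 v : lev v = 0 ->
  outer (piece v) /\ weak_diam_le (rig Hs) 2 (meeting Hs (piece v)).
Proof.
move=> lv; have dv0 u : lev u = 0 -> dv u = 0 by rewrite /lev; clear; lia.
have [vc|nvc] := boolP (v \in finset.cover Hs); last first.
  split; first by apply: outerS (uncovered_outer nvc); rewrite finset.sub1set component_of_refl.
  move=> a b; rewrite inE => /andP[aH /pred0Pn[x /andP[/= xa]]].
  rewrite inE => /connectP[[|y p] /= + xE].
    by move=> _; case/negP: nvc; rewrite -xE; exact: in_cover xa.
  case/andP=> /and3P[_ _ vy] _; have [H HH /andP[vH _]] := Hs_spans vy.
  by case/negP: nvc; exact: in_cover vH.
have [H [HH vH dH]] := dv_attained vc; rewrite dv0 // in dH.
split.
  apply: outerS (Hs_outer HH); apply/fintype.subsetP => y yH.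
  apply: (mem_piece_conn (Hs_conn HH)) => // w wH.
  by move: (dv_bounds HH wH); rewrite lv /lev dH; clear; lia.
have pieceH x : x \in piece v -> x \in H.
  rewrite /piece lv inE => /connectP[p + ->].
  elim: p v vH {vc lv} => //= w p IHp u uH /andP[/and3P[_]].
  rewrite inE => /eqP lw uw; apply: IHp.
  have [Z ZH /andP[uZ wZ]] := Hs_spans uw.
  have [Y [YH wY dY]] := dv_attained (in_cover ZH wZ); rewrite dv0 // in dY.
  suff -> : H = Y by [].
  have rE : fingraph.root (rig Hs) H = fingraph.root (rig Hs) Y.
    by apply: same_root; apply: connect_rig HH YH uH wY (connect1 uw).
  have /eqP -> : H == fingraph.root (rig Hs) H by rewrite eq_sym -d_eq0 dH.
  by rewrite rE; apply/eqP; rewrite -d_eq0 dY.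
move=> a b; rewrite !inE => /andP[aH /pred0Pn[x /andP[/= xa /pieceH xH]]].
move=> /andP[bH /pred0Pn[y /andP[/= yb /pieceH yH]]].
exact: (dist_le_trans (share_dist_le aH HH xa xH) (share_dist_le HH bH yH yb)).
Qed.

End Layers.

Theorem layered_partition (V : finType) (e : rel V) (outer : {set V} -> Prop)
    (Hs : {set {set V}}) :
  symmetric e ->
  (forall A B : {set V}, A \subset B -> outer A -> outer B) ->
  (forall (A : 'I_2 -> {set V}) (B : 'I_3 -> {set V}),
    (forall i, conn_set e (A i)) -> (forall j, conn_set e (B j)) ->
    [disjoint A ord0 & A ord_max] -> (forall j l, j != l -> [disjoint B j & B l]) ->
    (forall i j, touch e (A i) (B j)) -> (forall j, outer (B j)) -> False) ->
  (forall H, H \in Hs -> conn_set e H) -> spans e Hs ->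
  (forall H, H \in Hs -> outer H) ->
  (forall v, v \notin finset.cover Hs -> outer [set v]) ->
  exists Ms : {set {set V}},
    [/\ finset.trivIset Ms /\ finset.cover Ms = [set: V],
        forall M, M \in Ms -> conn_set e M,
        forall M, M \in Ms -> weak_diam_le (rig Hs) 25 (meeting Hs M)
      & forall M, M \in Ms -> (outer M /\ weak_diam_le (rig Hs) 2 (meeting Hs M)) \/
          (exists M', [/\ M' \in Ms, touch e M M' & outer M'])].
Proof.
move=> e_sym outerS no_K23 Hs_conn Hs_spans Hs_outer unc.
have [d [d_eq0 d_step d_pred]] := bfs_depth (@rig_sym _ Hs).
have /choice[dv dvP] : forall v, exists n, if v \in finset.cover Hs then
    (exists H, [/\ H \in Hs, v \in H & d H = n]) /\
    forall H, H \in Hs -> v \in H -> n <= d H else n = 0.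
  move=> v; have [/finset.bigcupP[H0 H0H vH0]|_] := boolP (v \in finset.cover Hs); last by exists 0.
  have P0 : (H0 \in Hs) && (v \in H0) by rewrite H0H.
  case: (@arg_minnP _ H0 (fun H => (H \in Hs) && (v \in H)) d P0) => H /andP[HH vH] mini.
  exists (d H); split; first by exists H.
  by move=> H' H'H vH'; apply: mini; rewrite H'H.
have dv_att v : v \in finset.cover Hs -> exists H, [/\ H \in Hs, v \in H & d H = dv v].
  by move=> vc; have := dvP v; rewrite vc => -[].
have dv_bounds H v : H \in Hs -> v \in H -> dv v <= d H <= (dv v).+1.
  move=> HH vH; have := dvP v; rewrite (in_cover HH vH) => -[[H' [H'H vH' <-]] ->] //=.
  have [[|Z p] [+ + sp]] := share_dist_le H'H HH vH' vH; first by move=> _ /= ->.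
  by case: p sp => //= _; rewrite andbT => /d_step + <-.
have dv_unc v : v \notin finset.cover Hs -> dv v = 0.
  by move=> /negPf vc; have := dvP v; rewrite vc.
pose pc := piece e dv.
have pcE u v : u \in pc v -> pc u = pc v by exact: piece_eq.
exists [set pc v | v : V].
have MsP M : M \in [set pc v | v : V] -> exists v, M = pc v.
  by case/imsetP => v _ ->; exists v.
split.
- split.
    apply/finset.trivIsetP => _ _ /MsP[u ->] /MsP[v ->]; apply: contraR => /pred0Pn[w].
    by move=> /andP[/= /pcE <- /pcE <-].
  apply/setP => v; rewrite inE; apply/bigcupP; exists (pc v); last exact: component_of_refl.
  exact: imset_f.
- by move=> _ /MsP[v ->]; exact: component_of_conn.
- move=> _ /MsP[v ->]; have [lv|lv] := posnP (lev dv v).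
    by move=> a b aM bM; apply: (@dist_leW _ _ 2) => //;
      exact: (piece_lev0 outerS Hs_conn Hs_spans Hs_outer unc d_eq0 dv_att dv_bounds lv).2.
  exact: (piece_diam e_sym outerS no_K23 Hs_conn Hs_spans Hs_outer d_eq0 d_pred
    dv_att dv_bounds lv).
- move=> _ /MsP[v ->]; have [lv|lv] := posnP (lev dv v).
    by left; exact: (piece_lev0 outerS Hs_conn Hs_spans Hs_outer unc d_eq0 dv_att dv_bounds lv).
  right; have [u [tvu ou]] := piece_touch e_sym outerS Hs_conn Hs_outer d_pred
    dv_att dv_bounds dv_unc lv.
  by exists (pc u); split=> //; exact: imset_f.
Qed.

Lemma meets_outerS (R : realType) (G : plane_graph R) (A B : {set vertex G}) :
  A \subset B -> meets_outer A -> meets_outer B.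
Proof.
move=> /fintype.subsetP AB [F outF [v vA vF]]; exists F => //.
by exists v => //; exact: AB.
Qed.

Lemma conn_set_isolated (V : finType) (e : rel V) (A : {set V}) (v : V) :
  (forall u, ~~ e v u) -> conn_set e A -> v \in A -> A = [set v]%SET.
Proof.
move=> iso /conn_setP[_ conA] vA; apply/setP => u; rewrite inE; apply/idP/eqP => [uA|->//].
have /connectP[[|w p] //= /andP[/and3P[_ _ vw] _]] := conA v u vA uA.
by case/negP: (iso w).
Qed.

Theorem theorem3p3 (R : realType) (G : plane_graph R)
    (Hs Bs : {set {set vertex G}})
    (Hs_conn : forall H, H \in Hs -> conn_set (adj G) H)
    (Hs_spans : spans (adj G) Hs)
    (Hs_outer : forall H, H \in Hs -> meets_outer H)
    (Bs_disj : finset.trivIset Bs)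
    (Bs_conn : forall B, B \in Bs -> conn_set (adj G) B)
    (Bs_diam : forall B, B \in Bs -> weak_diam_le (rig Hs) 30 (meeting Hs B))
    (Bs_outer : forall B, B \in Bs ->
      (meets_outer B /\ weak_diam_le (rig Hs) 10 (meeting Hs B)) \/
      (exists B', [/\ B' \in Bs, touch (adj G) B B' & meets_outer B']))
    (Ks_cases : forall K, is_component (adj G) (~: finset.cover Bs) K ->
      [\/ (weak_diam_le (rig Hs) 10 (meeting Hs K) /\ meets_outer K) \/
          (weak_diam_le (rig Hs) 30 (meeting Hs K) /\
           exists B, [/\ B \in Bs, touch (adj G) K B & meets_outer B]),
          meets_outer K /\
          (forall B, B \in Bs -> ~~ touch (adj G) K B),
          meets_outer K /\
          (exists! B, B \in Bs /\ touch (adj G) K B)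
        | meets_outer K /\
          (exists B1 B2,
            [/\ [/\ B1 \in Bs, B2 \in Bs & B1 <> B2],
                touch (adj G) K B1 /\ touch (adj G) K B2,
                forall B, B \in Bs -> touch (adj G) K B -> B = B1 \/ B = B2,
                meets_outer B1 /\ meets_outer B2
              & exists F, [/\ is_face G F, ~ is_outer_face G F,
                              meets_face B1 F & meets_face B2 F]])]) :
  exists Ms : {set {set vertex G}},
    [/\ finset.trivIset Ms /\ finset.cover Ms = finset.setT,
        forall M, M \in Ms -> conn_set (adj G) M,
        forall M, M \in Ms -> weak_diam_le (rig Hs) 30 (meeting Hs M)
      & forall M, M \in Ms ->
          (meets_outer M /\ weak_diam_le (rig Hs) 10 (meeting Hs M)) \/
          (exists M', [/\ M' \in Ms, touch (adj G) M M' & meets_outer M'])].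
Proof.
have unc v : v \notin finset.cover Hs -> meets_outer [set v]%SET.
  move=> nvc; have iso u : ~~ adj G v u.
    apply/negP => /Hs_spans[H HH /andP[vH _]].
    by case/negP: nvc; exact: in_cover HH vH.
  have untouched B : ~~ touch (adj G) [set v]%SET B.
    apply/negP => /andP[_ /exists_inP[u]]; rewrite inE => /eqP-> /exists_inP[w _].
    exact/negP.
  have [/finset.bigcupP[B BB vB]|nB] := boolP (v \in finset.cover Bs).
    have BE := conn_set_isolated iso (Bs_conn _ BB) vB.
    case: (Bs_outer _ BB) => [[]|[B' [_ + _]]]; first by rewrite BE.
    by rewrite BE (negPf (untouched B')).
  have K : is_component (adj G) (~: finset.cover Bs) [set v]%SET.
    apply/maxsetP; split.
      rewrite finset.sub1set inE nB andbT; apply/conn_setP; split.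
        by exists v; rewrite inE.
      by move=> u w; rewrite !inE => /eqP-> /eqP->; exact: connect0.
    move=> A /andP[conA _]; rewrite finset.sub1set; exact: conn_set_isolated.
  case: (Ks_cases _ K) => [[[]|[_ [B [_ tB _]]]]|[]|[]|[]] //.
  by rewrite (negPf (untouched B)) in tB.
have [|Ms [[tM cM] conM diamM outM]] := layered_partition
  (@adj_sym R G) (@meets_outerS R G) _ Hs_conn Hs_spans Hs_outer unc.
  move=> A B conA conB dA dB tAB outB.
  apply: (@no_outer_K23 R G A B) => //.
  by move: dA; congr (is_true [disjoint A _ & A _]%B); apply: val_inj.
exists Ms; split=> //.
- move=> M MM a b aM bM; apply: (@dist_leW _ _ 25) => //; exact: (diamM M).
- move=> M MM; case: (outM M MM) => [[oM dM]|]; [left|by right].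
  by split=> // a b aM bM; apply: (@dist_leW _ _ 2) => //; exact: dM.
Qed.
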